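(* Let $(T,X)$ be a minimal weakly almost periodic semiflow on a compact Hausdorff space $X$ with $T$ an amenable semigroup, such that for each $t\in T$ the map $x\mapsto tx$ is a bijection of $X$ onto itself. Then $(T,X)$ is uniformly almost periodic.
   Context: $X$ is a compact Hausdorff space with its (symmetric) uniform structure $\mathscr{U}_X$; for $x\in X$ and $\varepsilon\in\mathscr{U}_X$ write $\varepsilon[x]=\{y\in X : (x,y)\in\varepsilon\}$. A semiflow $(T,X)$ consists of a topological semigroup $T$ with neutral element $e$ and a jointly continuous map $T\times X\to X$, $(t,x)\mapsto tx$, with $ex=x$ and $(ts)x=t(sx)$ for all $s,t\in T$, $x\in X$. A topological semigroup $T$ is amenable if every semiflow $(T,Y)$ on a compact Hausdorff space $Y$ admits an invariant Borel probability measure on $Y$ (i.e. a Borel probability measure $\mu$ with $\mu(B)=\mu(t^{-1}B)$ for all Borel $B\subseteq Y$ and all $t\in T$, where $t^{-1}B=\{y: ty\in B\}$). $(T,X)$ is minimal if every orbit $Tx=\{tx:t\in T\}$, $x\in X$, is dense in $X$. $(T,X)$ is weakly almost periodic if for every $f\in C(X,\mathbb{R})$ the set $Tf=\{f_t : t\in T\}$, where $f_t(x)=f(tx)$, is relatively compact in $C(X,\mathbb{R})$ with the topology of pointwise convergence. A subset $A\subseteq T$ is syndetic if there is a compact $K\subseteq T$ with $Kt\cap A\neq\emptyset$ for every $t\in T$. $(T,X)$ is uniformly almost periodic if for every $\varepsilon\in\mathscr{U}_X$ there is a syndetic subset $A$ of $T$ such that $Ax\subseteq\varepsilon[x]$ for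 all $x\in X$. *)

(* Defs.v *)
From HB Require Import structures.
From mathcomp Require Import all_boot all_order all_algebra.
From mathcomp Require Import all_classical all_reals all_analysis.

Set Implicit Arguments.
Unset Strict Implicit.
Unset Printing Implicit Defensive.

Import numFieldNormedType.Exports.

Local Open Scope classical_set_scope.

HB.mixin Record Topological_isTopologicalMonoid M
    & Topological M & Monoid M := {
  mulg_continuous : continuous (fun p : M * M => (p.1 * p.2)%g) ;
}.

#[short(type="topologicalMonoidType")]
HB.structure Definition TopologicalMonoid :=
  {M of Topological M & Monoid M & Topological_isTopologicalMonoid M}.

Definition is_semiflow (T : topologicalMonoidType) (X : topologicalType)
    (act : T -> X -> X) : Prop :=
  [/\ continuous (fun p : T * X => act p.1 p.2),
      forall x, act 1%g x = x &
      forall s t x, act (t * s)%g x = act t (act s x)].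

(* The point of Y only records that Y is nonempty: the empty space carries a
   semiflow but no probability measure. *)
Definition amenable (R : realType) (T : topologicalMonoidType) : Prop :=
  forall (Y : ptopologicalType) (act : T -> Y -> Y),
    compact [set: Y] -> hausdorff_space Y -> is_semiflow act ->
    exists mu : probability (g_sigma_algebraType (@open Y)) R,
      forall (t : T) (B : set (g_sigma_algebraType (@open Y))),
        measurable B -> mu B = mu (act t @^-1` B).

Definition minimal_semiflow (T : topologicalMonoidType) (X : topologicalType)
    (act : T -> X -> X) : Prop :=
  forall x, dense [set act t x | t in [set: T]].

(* C(X, R) with the topology of pointwise convergence. *)
Definition Cp (R : realType) (X : topologicalType) : topologicalType :=
  initial_topology (fun f : continuousType X R => (f : {ptws X -> R})).

Definition translates (R : realType) (T : topologicalMonoidType)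
    (X : topologicalType) (act : T -> X -> X)
    (f : continuousType X R) : set (continuousType X R) :=
  [set g : continuousType X R | exists t : T, forall x, g x = f (act t x)].

(* The closure implicit in precompact is the one in Cp R X, not in X -> R. *)
Definition weakly_almost_periodic (R : realType) (T : topologicalMonoidType)
    (X : topologicalType) (act : T -> X -> X) : Prop :=
  forall f : continuousType X R, precompact (translates act f : set (Cp R X)).

Definition syndetic (T : topologicalMonoidType) (A : set T) : Prop :=
  exists2 K : set T, compact K &
    forall t, [set (k * t)%g | k in K] `&` A !=set0.

Definition uniformly_almost_periodic (T : topologicalMonoidType)
    (X : uniformType) (act : T -> X -> X) : Prop :=
  forall E : set (X * X), entourage E ->
    exists2 A : set T, syndetic A &
      forall x, [set act a x | a in A] `<=` xsection E x.

(* Main.v *)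
(* Fix an invariant probability measure mu: since every orbit is dense, nonempty
   open sets have positive measure.  For f in C(X, R), weak almost periodicity
   makes every sequence of translates of f have a subsequence converging
   pointwise to a continuous function, hence also in measure.  Such a
   subsequence is uniformly Cauchy: otherwise there are pairs (t, s) of
   far-out terms whose translates of f are close in measure but differ by more
   than d somewhere, and by density of the orbit of x0 at some point r x0.  The
   invariance of mu keeps f(t r .) and f(s r .) close in measure, while they
   differ by d at the fixed point x0; pointwise limits of these along a common
   subsequence are continuous, equal almost everywhere, and yet different at x0.

   Hence T is totally bounded for uniform convergence on X.  If s runs through a
   finite net and t^m, t^n (m < n) are uniformly close, then, t^m being onto,
   t^(n - m) is close to the identity, and so is s t for the s close to
   t^(n - m - 1): the net witnesses syndeticity. *)

Require Import Defs.
From HB Require Import structures.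
From mathcomp Require Import all_boot all_order all_algebra.
From mathcomp Require Import all_classical all_reals all_analysis.
From mathcomp Require Import lra zify.

Set Implicit Arguments.
Unset Strict Implicit.
Unset Printing Implicit Defensive.

Import Order.TTheory GRing.Theory Num.Theory.
Import numFieldNormedType.Exports.

Local Open Scope classical_set_scope.
Local Open Scope ring_scope.

(** * Sequences, subsequences and compactness *)

Lemma eq_dist_lt (R : realFieldType) (a b : R) :
  (forall e : R, 0 < e -> `|a - b| < e) -> a = b.
Proof.
move=> ab; apply/eqP; rewrite -subr_eq0 -normr_eq0; apply/negPn/negP => ab0.
by have := ab `|a - b|; rewrite ltxx lt_def ab0 normr_ge0 => /(_ isT).
Qed.

Lemma invS_lt (R : realType) (e : R) : 0 < e ->
  exists N : nat, forall n, (N <= n)%N -> n.+1%:R^-1 < e.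
Proof.
move=> e0; have /cvgrPdist_lt/(_ e e0)[N _ NP] := @cvg_harmonic R.
exists N => n Nn; have := NP n Nn.
by rewrite /= sub0r normrN ger0_norm// invr_ge0.
Qed.

(** Greedy choice beyond the previous value. Letting [P] depend on [k] allows the tolerance to
    shrink along the subsequence. *)
Lemma frequently_increasing (P : nat -> nat -> Prop) :
  (forall k N, exists2 n, (N <= n)%N & P k n) ->
  exists2 phi : nat -> nat, {homo phi : m n / (m < n)%N} &
    forall k, P k (phi k).
Proof.
move=> Pfreq.
pose next k N := projT1 (cid2 (Pfreq k N)).
have nextP k N : (N <= next k N)%N /\ P k (next k N).
  by rewrite /next; case: cid2.
pose phi := fix phi k :=
  if k is k'.+1 then next k (phi k').+1 else next 0%N 0%N.
exists phi; last by case=> [|k]; exact: (nextP _ _).2.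
by apply: (homo_ltn ltn_trans) => n; exact: (nextP n.+1 (phi n).+1).1.
Qed.

Lemma homo_ltn_ge (phi : nat -> nat) : {homo phi : m n / (m < n)%N} ->
  forall n, (n <= phi n)%N.
Proof.
by move=> phi_incr; elim=> // n ih; apply: leq_ltn_trans ih _; exact: phi_incr.
Qed.

Lemma compact_cover_seq (X : ptopologicalType) (I : choiceType)
    (U : I -> set X) :
  compact [set: X] -> (forall i, open (U i)) -> (forall x, exists i, U i x) ->
  exists s : seq I, forall x, exists2 i, i \in s & U i x.
Proof.
rewrite compact_cover => Xc Uo Ucov.
have [|D _ DU] := Xc I setT U (fun i _ => Uo i).
  by move=> x _; have [i] := Ucov x; exists i.
by exists (finmap.enum_fset D) => x; have [i] := DU x Logic.I; exists i.
Qed.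

Lemma compact_seq_cluster (X : topologicalType) (d : nat -> X) :
  compact [set: X] ->
  exists y : X, forall A N, nbhs y A -> exists2 n, (N <= n)%N & A (d n).
Proof.
move=> /(_ (d @ \oo)) [|y [_ yd]]; first exact: filterT.
exists y => A N Ay.
have [|_ [[n /= Nn <-] An]] := yd (d @` [set n | (N <= n)%N]) A _ Ay.
  by exists N => // n /= Nn; exists n.
by exists n.
Qed.

(** * Convergent subsequences from cluster functions *)

(** Cluster points in the product topology, tested on its basic neighbourhoods: a finite set [s] and
    a tolerance [e]. *)
Definition pointwise_cluster (R : realType) (X : eqType) (u : nat -> X -> R)
    (g : X -> R) :=
  forall (s : seq X) (e : R) (N : nat), 0 < e ->
    exists2 n, (N <= n)%N & {in s, forall x, `|u n x - g x| < e}.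

(* X need not be separable: the finite sets s N only approximate points for the
   pseudometrics |u n x - u n y|.  But each x has a twin y with the same values
   under all u n, hence under all cluster points, and y is a cluster point of a
   sequence of points of these sets, where the cluster points g and h agree. *)
Lemma cluster_subseq (R : realType) (X : ptopologicalType) (u : nat -> X -> R) :
  compact [set: X] -> (forall n, continuous (u n)) ->
  (forall phi : nat -> nat, {homo phi : m n / (m < n)%N} ->
    exists2 g : X -> R, continuous g & pointwise_cluster (u \o phi) g) ->
  exists phi : nat -> nat, {homo phi : m n / (m < n)%N} /\
    exists2 g : X -> R, continuous g &
      forall x, u (phi n) x @[n --> \oo] --> g x.
Proof.
move=> Xc u_cont u_cluster.
pose U N (y : X) := [set x | forall n, (n < N)%N -> `|u n x - u n y| < N.+1%:R^-1].
have Uo N y : open (U N y).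
  have -> : U N y = \bigcap_(n in `I_N) [set x | `|u n x - u n y| < N.+1%:R^-1].
    by apply/seteqP; split => x xU n; exact: xU.
  rewrite -closedC setC_bigcap; apply: closed_bigcup; first exact: finite_II.
  move=> n _; apply: open_closedC; apply: (open_comp _ (@open_lt _ N.+1%:R^-1)) => x _.
  apply: (@continuous_comp _ _ _ (fun x => u n x - u n y)); last exact: norm_continuous.
  by apply: continuousB; [exact: u_cont | exact: cst_continuous].
have /choice[s sP] N : exists s : seq X, forall x, exists2 y, y \in s & U N y x.
  apply: compact_cover_seq => // x; exists x => n _.
  by rewrite subrr normr0 invr_gt0.
(* [D] is cumulative, so that a point of [s N] is controlled at every stage [k >= N]. *)
pose D k := flatten [seq s j | j <- iota 0 k.+1].
have sD k N x : x \in s N -> (N <= k)%N -> x \in D k.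
  move=> xs Nk; apply/flattenP; exists (s N) => //; apply: map_f.
  by rewrite mem_iota add0n.
have [g g_cont g_cluster] := u_cluster id (fun m n mn => mn).
(* Since [u (phi k)] is within 1/(k+1) of [g] on [D k], it converges to [g] at the points of every
   [s N]. *)
have [k N|phi phi_incr phiP] := @frequently_increasing
    (fun k n => {in D k, forall x, `|u n x - g x| < k.+1%:R^-1}).
  by apply: g_cluster; rewrite invr_gt0.
exists phi; split => //; exists g => // x.
(* If convergence fails at [x], some [psi] keeps the values at distance at least [e] from [g x]. A
   cluster function [h] along [phi \o psi] then contradicts [h x = g x]. *)
apply/cvgrPdist_lt => e e0; apply: contrapT => not_near.
have [_ N|psi psi_incr psiP] := @frequently_increasing
    (fun _ k => e <= `|g x - u (phi k) x|).
  apply: contrapT => noN; apply: not_near; exists N => // k /= Nk.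
  by rewrite ltNge; apply/negP => ek; apply: noN; exists k.
have phipsi_incr : {homo phi \o psi : m n / (m < n)%N}.
  by move=> m n mn; apply: phi_incr; exact: psi_incr.
have [h h_cont h_cluster] := u_cluster _ phipsi_incr.
have hgs N y : y \in s N -> h y = g y.
  move=> ys; apply: eq_dist_lt => r r0.
  have r20 : 0 < r / 2 by rewrite divr_gt0.
  have [M MP] := invS_lt r20.
  have [n nMN /(_ y)] := h_cluster [:: y] (r / 2) (maxn M N) r20.
  rewrite mem_head => /(_ isT) /= uh.
  have psin := homo_ltn_ge psi_incr n.
  have /(_ y) ug := phiP (psi n).
  have yD : y \in D (psi n) by apply: (sD _ N) => //; lia.
  have /MP rM : (M <= psi n)%N by lia.
  rewrite distrC; move: (lt_trans (ug yD) rM) uh; rewrite !ltr_norml => /andP[? ?] /andP[? ?].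
  by apply/andP; split; lra.
have /choice[d dP] N : exists y, y \in s N /\ U N y x by have [y] := sP N x; exists y.
have [y yP] := compact_seq_cluster d Xc.
have uxy n : u n x = u n y.
  apply: eq_dist_lt => r r0.
  have r20 : 0 < r / 2 by rewrite divr_gt0.
  have [M MP] := invS_lt r20.
  have /cvgrPdist_lt/(_ (r / 2) r20) uy := u_cont n y.
  have [k kM /=] := yP _ (maxn M n.+1) uy.
  have /MP rM : (M <= k)%N by lia.
  have [_ /(_ n)] := dP k; move=> /(_ ltac:(lia)) /lt_trans/(_ rM).
  rewrite !ltr_norml => /andP[? ?] /andP[? ?].
  by apply/andP; split; lra.
have cluster_xy v (k : X -> R) : pointwise_cluster (u \o v) k -> k x = k y.
  move=> k_cluster; apply: eq_dist_lt => r r0.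
  have r20 : 0 < r / 2 by rewrite divr_gt0.
  have [n _ nP] := k_cluster [:: x; y] (r / 2) 0%N r20.
  have := nP x; have := nP y; rewrite !inE !eqxx orbT /= => /(_ isT) + /(_ isT).
  rewrite uxy !ltr_norml => /andP[? ?] /andP[? ?].
  by apply/andP; split; lra.
(* The continuous function [h - g] vanishes at all [d k], which cluster at [y]. *)
have hgy : h y = g y.
  apply: eq_dist_lt => r r0.
  have /cvgrPdist_lt/(_ r r0) hgc : {for y, continuous (h \- g)}.
    by apply: continuousB; [exact: h_cont | exact: g_cont].
  have [k _ /=] := yP _ 0%N hgc.
  by rewrite (hgs k (d k)) ?subrr ?subr0//; have [] := dP k.
have hgx : h x = g x by rewrite (cluster_xy _ _ h_cluster) hgy (cluster_xy _ _ g_cluster).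
have [n _ /(_ x)] := h_cluster [:: x] e 0%N e0.
by rewrite mem_head hgx distrC => /(_ isT) /=; rewrite ltNge psiP.
Qed.

(** * Translates in a weakly almost periodic semiflow *)

Lemma semiflow_continuous (T : topologicalMonoidType) (X : topologicalType)
    (act : T -> X -> X) (t : T) : is_semiflow act -> continuous (act t).
Proof.
move=> [act_cont _ _] x.
apply: (@continuous2_cvg _ _ _ _ _ _ (fun _ => t) id act t x).
- exact: (act_cont (t, x)).
- exact: cvg_cst.
- exact: cvg_id.
Qed.

(** The translates have compact closure in [Cp R X], so the sequence clusters at a point of that
    space, which is a continuous function. Evaluations are continuous on [Cp R X], so finitely many
    of them cut out a neighbourhood. *)
Lemma wap_pointwise_cluster (R : realType) (T : topologicalMonoidType)
    (X : topologicalType) (act : T -> X -> X) (f : continuousType X R)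
    (u : nat -> T) :
  is_semiflow act -> precompact (translates act f : set (Cp R X)) ->
  exists2 g : X -> R, continuous g &
    pointwise_cluster (fun n x => f (act (u n) x)) g.
Proof.
move=> act_sf; rewrite precompactE => fc.
have f_cont : continuous f by exact: cts_fun.
have /choice[F FE] t : exists h : continuousType X R, forall x, h x = f (act t x).
  have h_cont : continuous (f \o act t).
    by move=> x; apply: continuous_comp; [exact: semiflow_continuous | exact: f_cont].
  by exists (HB.pack_for (continuousType X R) (f \o act t)
    (isContinuous.Build _ _ _ h_cont)).
have [|g [_ g_cluster]] := fc ((fun n => F (u n) : Cp R X) @ \oo).
  by exists 0%N => // n _; apply: subset_closure; exists (u n) => x; rewrite FE.
exists g; first exact: cts_fun.
move=> s e N e0.
have eval_cont x : continuous (fun h : Cp R X => h x).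
  move=> h; apply: (@continuous_comp _ _ _ (fun k : Cp R X => (k : {ptws X -> R}))
    (fun k : {ptws X -> R} => k x)).
    exact: initial_continuous.
  exact: (@proj_continuous _ (fun=> R) x).
have near_g : nbhs (g : Cp R X) [set h : Cp R X | {in s, forall x, `|h x - g x| < e}].
  elim: s => [|x s ih]; first by near=> h.
  have /cvgrPdist_lt/(_ e e0) gx := eval_cont x g.
  near=> h => y; rewrite inE => /predU1P[->|ys].
    by rewrite distrC; near: h.
  by move: y ys; near: h.
have [|_ [[n /= Nn <-] gn]] :=
    g_cluster ((fun n => F (u n)) @` [set n | (N <= n)%N]) _ _ near_g.
  by exists N => // n /= Nn; exists n.
by exists n => // x /gn; rewrite FE.
Unshelve. all: by end_near.
Qed.

(** * Convergence in measure and full support of invariant measures *)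

Definition far (R : realType) (X : Type) (e : R) (f g : X -> R) : set X :=
  [set x | e <= `|f x - g x|].

Lemma continuous_dist (R : realType) (X : topologicalType) (f g : X -> R) :
  continuous f -> continuous g -> continuous (fun x => `|f x - g x|).
Proof.
move=> f_cont g_cont x.
apply: (@continuous_comp _ _ _ (fun x => f x - g x)); last exact: norm_continuous.
by apply: continuousB; [exact: f_cont | exact: g_cont].
Qed.

Lemma measurable_closed (X : ptopologicalType) (A : set X) :
  closed A -> measurable (A : set (g_sigma_algebraType (@open X))).
Proof.
move=> Ac; rewrite -[A]setCK; apply: measurableC.
by apply: sub_sigma_algebra; exact: closed_openC.
Qed.

Lemma measurable_far (R : realType) (X : ptopologicalType) (e : R) (f g : X -> R) :
  continuous f -> continuous g ->
  measurable (far e f g : set (g_sigma_algebraType (@open X))).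
Proof.
move=> f_cont g_cont; apply: measurable_closed.
apply: (@closed_comp _ _ (fun x => `|f x - g x|) [set r | e <= r]).
  by move=> x _; exact: continuous_dist.
exact: closed_ge.
Qed.

Lemma far_triangle (R : realType) (X : ptopologicalType)
    (mu : probability (g_sigma_algebraType (@open X)) R)
    (e1 e2 : R) (f g h : X -> R) :
  continuous f -> continuous g -> continuous h ->
  (mu (far (e1 + e2) f h) <= mu (far e1 f g) + mu (far e2 g h))%E.
Proof.
move=> f_cont g_cont h_cont.
apply: le_trans (measureU2 mu _ _); try exact: measurable_far.
apply: le_measure; rewrite ?inE.
- exact: measurable_far.
- by apply: measurableU; exact: measurable_far.
move=> x; rewrite /far /= => le_fh.
case: (leP e1 `|f x - g x|) => [|lt_fg]; first by left.
right; have := ler_distD (g x) (f x) (h x); lra.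
Qed.

(** Pointwise convergence makes the tail unions [F N] decrease to the empty set; continuity from
    above of the finite measure [mu] concludes. *)
Lemma cvg_in_measure (R : realType) (X : ptopologicalType)
    (mu : probability (g_sigma_algebraType (@open X)) R)
    (u : nat -> X -> R) (g : X -> R) (e c : R) :
  (forall n, continuous (u n)) -> continuous g ->
  (forall x, u n x @[n --> \oo] --> g x) -> 0 < e -> 0 < c ->
  exists N, forall n, (N <= n)%N -> (mu (far e (u n) g) < c%:E)%E.
Proof.
move=> u_cont g_cont ug e0 c0.
pose F N : set (g_sigma_algebraType (@open X)) :=
  \bigcup_(n in [set n | (N <= n)%N]) far e (u n) g.
have Fm N : measurable (F N).
  by apply: bigcup_measurable => n _; exact: measurable_far.
have F0 : \bigcap_N F N = set0.
  apply/seteqP; split=> // x xF.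
  have /cvgrPdist_lt/(_ e e0)[N _ NP] := ug x.
  have [n Nn] := xF N Logic.I; rewrite /far /= distrC => en.
  by have := NP n Nn; rewrite /= ltNge en.
have Fdec : {homo F : n m / (n <= m)%N >-> (m <= n)%O}.
  move=> m n mn; apply/subsetPset => x [k /= nk xk].
  by exists k => //=; exact: leq_trans nk.
have : (mu \o F) x @[x --> \oo] --> mu (\bigcap_N F N).
  apply: nonincreasing_cvg_mu => //.
    by apply: le_lt_trans (probability_le1 mu (Fm 0%N)) _; rewrite ltry.
  exact: bigcapT_measurable.
rewrite F0 measure0 => /(_ [set r | (r < c%:E)%E]) [|N _ NP].
  apply: open_nbhs_nbhs; split; first exact: open_ereal_lt_ereal.
  by rewrite /= lte_fin.
exists N => n Nn; apply: le_lt_trans (NP N _); last exact: leqnn.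
apply: le_measure; rewrite ?inE; [exact: measurable_far | exact: Fm|].
by move=> x xn; exists n.
Qed.

(** Every orbit meets [U], so by compactness finitely many preimages of [U] cover the space. By
    invariance they all have the measure of [U]; if it were zero, the whole space would be null. *)
Lemma invariant_full_support (R : realType) (T : topologicalMonoidType)
    (X : ptopologicalType) (act : T -> X -> X)
    (mu : probability (g_sigma_algebraType (@open X)) R) (U : set X) :
  compact [set: X] -> is_semiflow act -> minimal_semiflow act ->
  (forall (t : T) (B : set (g_sigma_algebraType (@open X))),
    measurable B -> mu B = mu (act t @^-1` B)) ->
  open U -> U !=set0 -> (0 < mu U)%E.
Proof.
move=> Xc act_sf act_min mu_inv Uo U0.
have tUo t : open (act t @^-1` U).
  by apply: open_comp => // x _; exact: semiflow_continuous.
have meas A : open A -> measurable (A : set (g_sigma_algebraType (@open X))).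
  by move=> Ao; exact: sub_sigma_algebra.
have [|s sP] := compact_cover_seq Xc tUo.
  by move=> x; have [y [Uy [t _ tx]]] := act_min x U U0 Uo; exists t; rewrite /= tx.
rewrite lt_neqAle measure_ge0 andbT eq_sym; apply/eqP => muU0.
pose V := fun s : seq T => [set x | exists2 t, t \in s & U (act t x)].
have Vnull s' : measurable (V s' : set (g_sigma_algebraType (@open X))) /\
    mu (V s') = 0%E.
  elim: s' => [|t s' [Vm V0]].
    have -> : V [::] = set0 by apply/seteqP; split=> // x [].
    by rewrite measure0.
  have -> : V (t :: s') = act t @^-1` U `|` V s'.
    apply/seteqP; split=> x.
      by move=> [r]; rewrite inE => /predU1P[->|rs] Ur; [left | right; exists r].
    case=> [Utx|[r rs Ur]]; first by exists t; rewrite ?mem_head.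
    by exists r; rewrite // inE rs orbT.
  split; first by apply: measurableU => //; exact: meas.
  apply: null_set_setU => //; first exact: meas.
  exact: etrans (esym (mu_inv t U (meas _ Uo))) muU0.
have VT : V s = setT by apply/seteqP; split=> // x _; exact: sP.
have [_] := Vnull s; rewrite VT => muT0.
by have := probability_setT mu; rewrite muT0 => /eqP; rewrite eq_sym onee_eq0.
Qed.

(** * From closeness in measure to uniform closeness *)

Lemma wap_uniform_cauchy (R : realType) (T : topologicalMonoidType)
    (X : ptopologicalType) (act : T -> X -> X)
    (mu : probability (g_sigma_algebraType (@open X)) R)
    (f : continuousType X R) (u : nat -> T) (g : X -> R) (d : R) :
  compact [set: X] -> is_semiflow act -> minimal_semiflow act ->
  precompact (translates act f : set (Cp R X)) ->
  (forall (t : T) (B : set (g_sigma_algebraType (@open X))),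
    measurable B -> mu B = mu (act t @^-1` B)) ->
  continuous g -> (forall x, f (act (u n) x) @[n --> \oo] --> g x) -> 0 < d ->
  exists N, forall m n, (N <= m)%N -> (N <= n)%N ->
    forall x, `|f (act (u m) x) - f (act (u n) x)| <= d.
Proof.
move=> Xc act_sf act_min f_wap mu_inv g_cont ug d0.
pose F t x := f (act t x).
have F_cont t : continuous (F t).
  have f_cont : continuous f by exact: cts_fun.
  by move=> x; apply: continuous_comp; [exact: semiflow_continuous | exact: f_cont].
apply: contrapT => notN.
have pairs (k : nat) : exists ab : T * T, d < `|F ab.1 point - F ab.2 point| /\
    (mu (far (d / 4%:R) (F ab.1) (F ab.2)) < (k.+1%:R^-1)%:E)%E.
  pose c : R := k.+1%:R^-1 / 2.
  have c0 : 0 < c by rewrite divr_gt0// invr_gt0.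
  have e0 : 0 < d / 8%:R by rewrite divr_gt0.
  have [N NP] := cvg_in_measure mu (fun n => F_cont (u n)) g_cont ug e0 c0.
  have [m [n [Nm Nn [x dx]]]] : exists m n, [/\ (N <= m)%N, (N <= n)%N &
      exists x, d < `|F (u m) x - F (u n) x|].
    apply: contrapT => no; apply: notN; exists N => m n Nm Nn x.
    by rewrite leNgt; apply/negP => dx; apply: no; exists m, n; split=> //; exists x.
  (* The discrepancy holds on a nonempty open set, which the orbit of [point] meets. Multiplying on
     the right by [r] moves it to [point], and the exceptional set becomes a preimage under [act r],
     of the same measure. *)
  have [y [/= dy [r _ ry]]] := act_min point
    [set x | d < `|F (u m) x - F (u n) x|] (ex_intro _ x dx)
    (open_comp (fun x _ => continuous_dist (F_cont (u m)) (F_cont (u n)) (x := x))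
      (@open_gt _ d)).
  have FM t z : F (t * r)%g z = F t (act r z) by case: act_sf => _ _ am; rewrite /F am.
  exists ((u m * r)%g, (u n * r)%g); split; first by rewrite /= !FM ry.
  have -> : far (d / 4%:R) (F (u m * r)%g) (F (u n * r)%g) =
      act r @^-1` (far (d / 4%:R) (F (u m)) (F (u n))).
    by apply/seteqP; split=> z; rewrite /far /= !FM.
  rewrite -mu_inv; last exact: measurable_far.
  (* Both translates are compared with the limit [g], each using half of the distance and half of
     the measure. *)
  have -> : d / 4%:R = d / 8%:R + d / 8%:R by lra.
  apply: le_lt_trans (far_triangle mu _ _ (F_cont _) g_cont (F_cont _)) _.
  have -> : k.+1%:R^-1 = c + c by rewrite /c -splitr.
  rewrite EFinD; apply: lteD; first exact: NP.
  have -> : far (d / 8%:R) g (F (u n)) = far (d / 8%:R) (F (u n)) g.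
    by apply/seteqP; split=> z; rewrite /far /= distrC.
  exact: NP.
have {pairs}/choice[ab abP] := pairs.
pose a n := (ab n).1; pose b n := (ab n).2.
have subseq (v : nat -> T) := cluster_subseq Xc (fun n => F_cont (v n))
  (fun phi _ => wap_pointwise_cluster (v \o phi) act_sf f_wap).
have [phi1 [phi1_incr [g1 g1_cont ag1]]] := subseq a.
have [phi2 [phi2_incr [g2 g2_cont bg2]]] := subseq (b \o phi1).
pose phi n := phi1 (phi2 n).
have phi_ge n : (n <= phi n)%N.
  by apply: leq_trans (homo_ltn_ge phi2_incr n) _; exact: homo_ltn_ge.
have {}ag1 x : F (a (phi n)) x @[n --> \oo] --> g1 x.
  apply/cvgrPdist_lt => e e0; have /cvgrPdist_lt/(_ e e0)[N _ NP] := ag1 x.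
  exists N => // n Nn; apply: NP => /=.
  exact: leq_trans Nn (homo_ltn_ge phi2_incr n).
pose U := [set x | d / 2 < `|g1 x - g2 x|].
have Uo : open U.
  apply: (@open_comp _ _ (fun x => `|g1 x - g2 x|) [set r | d / 2 < r]); last exact: open_gt.
  by move=> x _; exact: continuous_dist.
(* At [point] the two sequences stay more than [d] apart; passing to the limits costs at most d/4 on
   each side, which leaves d/2. *)
have U0 : U !=set0.
  exists point; rewrite /U /= ltNge; apply/negP => le_d.
  have e0 : 0 < d / 4%:R by rewrite divr_gt0.
  have /cvgrPdist_lt/(_ _ e0)[N1 _ N1P] := ag1 point.
  have /cvgrPdist_lt/(_ _ e0)[N2 _ N2P] := bg2 point.
  have := N1P (maxn N1 N2) (leq_maxl _ _).
  have := N2P (maxn N1 N2) (leq_maxr _ _).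
  have [] := abP (phi (maxn N1 N2)).
  rewrite -/(a _) -/(b _) /=; set p := F _ _; set q := F _ _ => dpq _ qg2 pg1.
  have := ler_distD (g1 point) p q; have := ler_distD (g2 point) (g1 point) q.
  rewrite (distrC p (g1 _)); lra.
have := invariant_full_support Xc act_sf act_min mu_inv Uo U0.
apply/negP; rewrite -leNgt; apply/lee_addgt0Pr => e e0; rewrite add0e.
have e30 : 0 < e / 3%:R by rewrite divr_gt0.
have d80 : 0 < d / 8%:R by rewrite divr_gt0.
have [N1 N1P] := cvg_in_measure mu (fun n => F_cont (a (phi n))) g1_cont ag1 d80 e30.
have [N2 N2P] := cvg_in_measure mu (fun n => F_cont (b (phi n))) g2_cont bg2 d80 e30.
have [N3 N3P] := invS_lt e30.
pose n := maxn N1 (maxn N2 N3).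
have {}N1P := N1P n (leq_maxl _ _).
have {}N2P : (mu (far (d / 8%:R) (F (b (phi n))) g2) < (e / 3%:R)%:E)%E.
  by apply: N2P; rewrite /n; lia.
have [_ abn] := abP (phi n).
have {}N3P : (mu (far (d / 4%:R) (F (a (phi n))) (F (b (phi n)))) < (e / 3%:R)%:E)%E.
  apply: (lt_trans abn); rewrite lte_fin; apply: N3P.
  by apply: leq_trans (phi_ge n); rewrite /n; lia.
(* The distance d/2 splits as d/8 + d/4 + d/8 along [g1], [F (a (phi n))], [F (b (phi n))], [g2];
   each piece contributes at most e/3. *)
have UE : (mu U <= mu (far (d / 8%:R + (d / 4%:R + d / 8%:R)) g1 g2))%E.
  apply: le_measure; rewrite ?inE; [exact: sub_sigma_algebra | exact: measurable_far |].
  by move=> x; rewrite /U /far /=; lra.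
apply: (le_trans UE).
apply: le_trans (far_triangle mu _ _ g1_cont (F_cont (a (phi n))) g2_cont) _.
apply: le_trans (leeD2l _ (far_triangle mu _ _ (F_cont _) (F_cont (b (phi n))) g2_cont)) _.
have -> : e = e / 3%:R + (e / 3%:R + e / 3%:R) by lra.
rewrite 2!EFinD; apply: leeD; last by apply: leeD; exact: ltW.
have -> : far (d / 8%:R) g1 (F (a (phi n))) = far (d / 8%:R) (F (a (phi n))) g1.
  by apply/seteqP; split=> z; rewrite /far /= distrC.
exact: ltW.
Qed.

(** * Reducing an entourage to finitely many functions *)

(** By complete regularity some [F x] vanishes at [x] and equals 1 off [V x]. Finitely many sets
    [F x < 1/2] cover the space. If [F x y < 1/2] and [F x] varies by at most 1/4 between [y] and
    [z], then [F x z < 1], so both points lie in [V x]. *)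
Lemma entourage_functions (R : realType) (X : puniformType) (E : set (X * X)) :
  compact [set: X] -> entourage E ->
  exists fs : seq (continuousType X R), forall x y,
    {in fs, forall f : continuousType X R, `|f x - f y| <= 4%:R^-1} -> E (x, y).
Proof.
move=> Xc entE.
pose E1 := split_ent E `&` (split_ent E)^-1%relation.
have entE1 : entourage E1.
  by apply: filterI; [|apply: entourage_inv]; exact: entourage_split_ent.
pose V x := (xsection E1 x)°.
have VE x y : V x y -> E1 (x, y) by move=> /interior_subset; rewrite /xsection /= inE.
have /choice[F FP] x : exists f : continuousType X R, f x = 0 /\
    forall y, f y < 1 -> V x y.
  have Vc : closed (~` V x) by exact/open_closedC/open_interior.
  have nVx : ~ (~` V x) x.
    by move=> /(_ (nbhs_entourage x entE1)).
  have /(@uniform_separatorP _ R)[f [f_cont _ f0 f1]] :=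
    @point_uniform_separator R X x _ Vc nVx.
  exists (HB.pack_for (continuousType X R) f (isContinuous.Build _ _ _ f_cont)).
  split=> [|y /= fy1]; first by apply: f0; exists x.
  apply: contrapT => nVy; move: fy1; have /= -> : f y = 1 by apply: f1; exists y.
  by rewrite ltxx.
have Uo x : open [set y | F x y < 2^-1].
  apply: (@open_comp _ _ (F x) [set r | r < 2^-1]); last exact: open_lt.
  by move=> y _; exact: cts_fun.
have [|s sP] := compact_cover_seq Xc Uo.
  by move=> x; exists x; rewrite /= (FP x).1 invr_gt0.
exists (map F s) => y z Fyz.
have [x xs /= Fxy] := sP y.
have {}Fyz : F x z < 1.
  have /Fyz : F x \in map F s by exact: map_f.
  by rewrite ler_norml => /andP[? ?]; lra.
have [_ Eyx] : E1 (x, y) by apply/VE/(FP x).2; lra.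
have [Exz _] : E1 (x, z) by apply/VE/(FP x).2.
exact: entourage_split entE Eyx Exz.
Qed.

(** One refinement [psi] per function of [fs]; the bounds already obtained survive it because
    [psi m >= m]. *)
Lemma wap_subseq_cauchy (R : realType) (T : topologicalMonoidType)
    (X : ptopologicalType) (act : T -> X -> X)
    (mu : probability (g_sigma_algebraType (@open X)) R)
    (fs : seq (continuousType X R)) (u : nat -> T) (d : R) :
  compact [set: X] -> is_semiflow act -> minimal_semiflow act ->
  weakly_almost_periodic R act ->
  (forall (t : T) (B : set (g_sigma_algebraType (@open X))),
    measurable B -> mu B = mu (act t @^-1` B)) ->
  0 < d ->
  exists2 phi : nat -> nat, {homo phi : m n / (m < n)%N} &
    exists N, forall m n, (N <= m)%N -> (N <= n)%N ->
      forall x, {in fs, forall f : continuousType X R,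
        `|f (act (u (phi m)) x) - f (act (u (phi n)) x)| <= d}.
Proof.
move=> Xc act_sf act_min act_wap mu_inv d0.
elim: fs => [|f fs [phi phi_incr [N NP]]].
  by exists id => //; exists 0%N.
have F_cont n : continuous (fun x => f (act (u (phi n)) x)).
  have f_cont : continuous f by exact: cts_fun.
  by move=> x; apply: continuous_comp; [exact: semiflow_continuous | exact: f_cont].
have [psi [psi_incr [g g_cont ug]]] := cluster_subseq Xc F_cont
  (fun psi _ => wap_pointwise_cluster (u \o phi \o psi) act_sf (act_wap f)).
have [M MP] := wap_uniform_cauchy (u := u \o phi \o psi)
  Xc act_sf act_min (act_wap f) mu_inv g_cont ug d0.
exists (phi \o psi); first by move=> m n mn; apply: phi_incr; exact: psi_incr.
exists (maxn M N) => m n; rewrite !geq_max => /andP[Mm Nm] /andP[Mn Nn] x h.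
rewrite inE => /predU1P[->|hfs]; first exact: MP.
apply: NP => //.
- exact: leq_trans Nm (homo_ltn_ge psi_incr m).
- exact: leq_trans Nn (homo_ltn_ge psi_incr n).
Qed.

(** * From recurrence to syndeticity *)

(** Without a finite net one can always choose a new term to which no earlier term is near, and the
    resulting sequence contradicts the hypothesis. *)
Lemma finite_net (T : Type) (near : T -> T -> Prop) :
  (forall u : nat -> T, exists m n, (m < n)%N /\ near (u m) (u n)) ->
  exists s : seq T, forall t, exists2 r, List.In r s & near r t.
Proof.
move=> near_seq; apply: contrapT => no_net.
have /choice[next nextP] (s : seq T) : exists t, forall r, List.In r s -> ~ near r t.
  apply: contrapT => no_t; apply: no_net; exists s => t; apply: contrapT => no_r.
  by apply: no_t; exists t => r rs rt; apply: no_r; exists r.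
pose s := fix s n := if n is n'.+1 then next (s n') :: s n' else [::].
have [m [n [mn]]] := near_seq (next \o s).
apply: nextP.
elim: n mn => // n ih; rewrite ltnS leq_eqVlt => /predU1P[->|mn] /=; first by left.
by right; exact: ih.
Qed.

Lemma uniformly_almost_periodic_of_recurrence (T : topologicalMonoidType)
    (X : uniformType) (act : T -> X -> X) :
  is_semiflow act -> (forall t, bijective (act t)) ->
  (forall (E : set (X * X)) (u : nat -> T), entourage E -> exists m n, (m < n)%N /\
    forall x, E (act (u m) x, act (u n) x)) ->
  uniformly_almost_periodic act.
Proof.
move=> [_ act1 actM] act_bij recur E entE.
(* Symmetrized, because the net is used below in the reverse direction, from the power of [t] to
   [r]. *)
pose E1 := split_ent E `&` (split_ent E)^-1%relation.
have entE1 : entourage E1.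
  by apply: filterI; [|apply: entourage_inv]; exact: entourage_split_ent.
have [s sP] := @finite_net T (fun t r => forall x, E1 (act t x, act r x))
  (fun u => recur E1 u entE1).
exists [set a | forall x, E (x, act a x)]; last first.
  by move=> x _ [a aP <-]; rewrite /xsection /= inE.
exists [set t | List.In t s].
  apply: finite_compact; elim: {sP}s => [|t s ih].
    by have -> : [set t : T | List.In t [::]] = set0 by apply/seteqP; split.
  have -> : [set r | List.In r (t :: s)] = [set t] `|` [set r | List.In r s].
    by apply/seteqP; split=> r /= [->|?]; [left|right|left|right].
  by rewrite finite_setU; split.
move=> t.
pose pow k := iter k (fun r => (r * t)%g) 1%g.
have powD m k x : act (pow (k + m)%N) x = act (pow k) (act (pow m) x).
  elim: m x => [|m ih] x; first by rewrite addn0 /= act1.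
  by rewrite addnS /= !actM ih.
have [m [n [mn mnP]]] := recur E1 pow entE1.
(* As [m < n], the predecessor is genuine: [r] approximates the power which, times [t], gives
   [pow (n - m)]. *)
have [r rs rP] := sP (pow (n - m).-1).
exists (r * t)%g; split; first by exists r.
move=> y /=.
(* Surjectivity writes [y] as [act (pow m) (inv y)], so recurrence at [inv y] says that
   [act (pow (n - m)) y] is close to [y]. *)
have [inv _ invK] := act_bij (pow m).
have := mnP (inv y); rewrite -[in pow n](subnK (ltnW mn)) powD invK => -[nP _].
have [_ /= rE] := rP (act t y).
rewrite actM; apply: (entourage_split _ entE nP).
have -> : pow (n - m)%N = (pow (n - m).-1 * t)%g.
  by rewrite -[in LHS](prednK (n := n - m)) // subn_gt0.
by rewrite actM.
Qed.

Theorem theorem2p31 (R : realType) (T : topologicalMonoidType)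
    (X : uniformType) (act : T -> X -> X)
    (Xcompact : compact [set: X]) (Xhausdorff : hausdorff_space X)
    (Tamenable : amenable R T)
    (act_semiflow : is_semiflow act)
    (act_minimal : minimal_semiflow act)
    (act_wap : weakly_almost_periodic R act)
    (act_bij : forall t : T, bijective (act t)) :
  uniformly_almost_periodic act.
Proof.
apply: uniformly_almost_periodic_of_recurrence => // E u entE.
(* Amenability applies to pointed spaces; over the empty space recurrence holds vacuously. *)
have [[x0 _]|X0] := pselect ([set: X] !=set0); last first.
  exists 0%N, 1%N; split=> // x; case: X0; exists x; exact: Logic.I.
(* The same uniform space with base point [x0], which becomes the [point] of the lemmas above. *)
pose Y : puniformType := HB.pack_for puniformType X (isPointed.Build X x0).
have [mu mu_inv] := Tamenable Y act Xcompact Xhausdorff act_semiflow.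
have [fs fsP] := @entourage_functions R Y E Xcompact entE.
have d0 : 0 < 4%:R^-1 :> R by rewrite invr_gt0.
have [phi phi_incr [N NP]] := wap_subseq_cauchy fs u
  (Xcompact : compact [set: Y]) act_semiflow act_minimal act_wap mu_inv d0.
exists (phi N), (phi N.+1); split; first exact: phi_incr.
by move=> x; apply: fsP; exact: NP.
Qed.
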